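(* Let $\lambda,\mu,\nu\vdash n$ with $\ell(\lambda)=\ell$, $\ell(\mu)=m$, $\ell(\nu)=r$. Then $$g(\lambda,\mu,\nu)\;\le\; r!\cdot p(n)^{3r-2}\cdot n^{r-1}\cdot(\ell+\lambda_1)^{r\ell^2/2}\,(m+\mu_1)^{r m^2/2}.$$
   Context: $\ell(\lambda)$ is the number of parts of $\lambda$, $\lambda_1$ its largest part, and $p(n)$ the number of partitions of $n$. The Kronecker coefficient is $g(\lambda,\mu,\nu)=\frac{1}{n!}\sum_{\sigma\in S_n}\chi^\lambda(\sigma)\chi^\mu(\sigma)\chi^\nu(\sigma)$, with $\chi^\lambda$ the irreducible $S_n$-character indexed by $\lambda$. *)

(* Defs.v *)
From HB Require Import structures.
From mathcomp Require Import all_boot all_order all_fingroup all_algebra.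
From mathcomp Require Import all_solvable all_field all_character.

Set Implicit Arguments.
Unset Strict Implicit.
Unset Printing Implicit Defensive.

Import Order.TTheory GroupScope GRing.Theory Num.Theory.
Local Open Scope ring_scope.

(* [la] is a partition of [n]: a weakly decreasing list of positive parts of
   sum [n]. Its length [ell(la)] is [size la] and [la_1] is [head 0%N la]. *)
Definition is_partition (n : nat) (la : seq nat) : bool :=
  [&& sorted geq la, 0%N \notin la & sumn la == n].

(* A partition of [n] has at most [n] parts, each at most [n], so counting over
   the finite type below misses none: see [is_partition_bseq]. *)
Definition num_partitions (n : nat) : nat :=
  #|[set t : n.-bseq 'I_n.+1 | is_partition n [seq val x | x <- t]]|.

Lemma is_partition_bseq (n : nat) (la : seq nat) :
  is_partition n la -> exists t : n.-bseq 'I_n.+1, [seq val x | x <- t] = la.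
Proof.
case/and3P=> _ la0 /eqP defn.
have le_size : (size la <= n)%N.
  rewrite -defn; elim: la la0 {defn} => //= x la IH.
  rewrite inE negb_or eq_sym => /andP[x0 /IH le_la].
  by rewrite -add1n leq_add // lt0n.
have le_la x : x \in la -> (x <= n)%N.
  rewrite -defn; elim: la {la0 le_size defn} => //= y la IH.
  rewrite inE => /orP[/eqP-> | /IH le_x]; first exact: leq_addr.
  exact: leq_trans le_x (leq_addl _ _).
have le_size' : (size [seq (inord x : 'I_n.+1) | x <- la] <= n)%N.
  by rewrite size_map.
exists (Bseq le_size'); rewrite /= -map_comp -[RHS]map_id.
by apply/eq_in_map => x /le_la le_x /=; rewrite inordK.
Qed.

(* The boxes of the Young diagram of [la] are numbered 0, ..., n-1 row by row;
   [reshape_index la i] and [reshape_offset la i] are the row and the column of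
   the box numbered [i]. *)
Definition row_group (n : nat) (la : seq nat) : {set 'S_n} :=
  [set s : 'S_n | [forall i, reshape_index la (s i) == reshape_index la i]].

Definition col_group (n : nat) (la : seq nat) : {set 'S_n} :=
  [set s : 'S_n | [forall i, reshape_offset la (s i) == reshape_offset la i]].

Definition Sym_regular (n : nat) :=
  regular_repr algC [set: 'S_n]%G.

(* The Young symmetrizer [(\sum_p p) (\sum_q sgn(q) q)] of the group algebra,
   [p] and [q] ranging over the row and column groups. *)
Definition young_symmetrizer (n : nat) (la : seq nat) :=
  gring_row ((\sum_(p in row_group n la) Sym_regular n p) *m
             (\sum_(q in col_group n la) (-1) ^+ (q : bool) *: Sym_regular n q)).

(* The Specht module of [la], as the right ideal generated by the Young
   symmetrizer: the product of permutations being read from left to right,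
   right ideals here are left ideals for the usual composition. *)
Definition specht_repr (n : nat) (la : seq nat) :=
  submod_repr (cyclic_mx_module (Sym_regular n) (young_symmetrizer n la)).

Definition specht_char (n : nat) (la : seq nat) : 'CF([set: 'S_n]) :=
  cfRepr (specht_repr n la).

Definition kronecker (n : nat) (la mu nu : seq nat) : algC :=
  (n`!)%:R^-1 *
  \sum_(s : 'S_n) specht_char n la s * specht_char n mu s * specht_char n nu s.

(* Main.v *)
(* The Specht module of [la] is the right ideal [a b A] generated by a Young
   symmetrizer, so it lies in the right ideal [a A], which is the permutation
   module on the tabloids of shape [la].  As multiplicities are nonnegative,
   [g(la, mu, nu)] is at most the number of orbits of [S_n] on triples of
   tabloids.  Such an orbit is determined by an [l * m * r] array of natural
   numbers bounded by [c = min(la_1, mu_1)], so there are at most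
   [(c + 1)^(l m r)] of them, and [2 l m <= l^2 + m^2] finishes. *)
Require Import Defs.
From HB Require Import structures.
From mathcomp Require Import all_boot all_order all_fingroup all_algebra.
From mathcomp Require Import all_solvable all_field all_character.
Import Order.TTheory GRing.Theory Num.Theory.
Local Open Scope ring_scope.

Set Implicit Arguments.
Unset Strict Implicit.
Unset Printing Implicit Defensive.

(** * Characters of submodules *)

(** An idempotent is the identity on its row space. Writing [E] as coordinates times a basis [B] of
    that space, the two factors multiply to 1 in the other order, and cyclicity of the trace
    concludes. *)
Lemma mxtrace_submod_idem (F : fieldType) (gT : finGroupType) (G : {group gT})
    (n : nat) (rG : mx_representation F G n) (E : 'M_n) (modE : mxmodule rG E) :
  E *m E = E -> {in G, forall x, \tr (submod_repr modE x) = \tr (E *m rG x)}.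
Proof.
move=> idE x Gx; pose B := val_submod (1%:M : 'M_(\rank E)).
have BE : B *m E = B.
  have /submxP[D defB] : (B <= E)%MS by rewrite val_submodP.
  by rewrite defB -mulmxA idE.
have defE : E = in_submod E E *m B by rewrite -val_submodE in_submodK.
have BC : B *m in_submod E E = 1%:M.
  by apply: val_submod_inj; rewrite val_submodE -mulmxA -defE BE.
have BJ : submod_repr modE x *m B = B *m rG x.
  by rewrite -val_submodE -[submod_repr _ _]mul1mx val_submodJ.
have -> : E *m rG x = in_submod E E *m (submod_repr modE x *m B).
  by rewrite BJ mulmxA -defE.
by rewrite [RHS]mxtrace_mulC -[in RHS]mulmxA BC mulmx1.
Qed.

(** By Maschke [U] has an invariant complement in [V], and the difference is its character. *)
Lemma cfRepr_submod_le (gT : finGroupType) (G : {group gT}) (n : nat)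
    (rG : mx_representation algC G n) (U V : 'M_n)
    (modU : mxmodule rG U) (modV : mxmodule rG V) :
  (U <= V)%MS ->
  cfRepr (submod_repr modV) - cfRepr (submod_repr modU) \is a character.
Proof.
move=> sUV.
have [W modW defV dxUW] := mx_reducibleS modV (submx1 V)
  (mx_Maschke_pchar rG (algC'G_pchar G)) modU sUV.
suff -> : cfRepr (submod_repr modV) - cfRepr (submod_repr modU)
        = cfRepr (submod_repr modW) by apply: cfRepr_char.
apply/cfun_inP => x Gx; rewrite !cfunE Gx !mulr1n.
by rewrite -(mxtrace_dadd_mod modU modW modV defV dxUW Gx) addrC addKr.
Qed.

(** * The permutation module on cosets, as a right ideal of the group algebra *)

Section PermutationModule.

Variables (gT : finGroupType) (G H : {group gT}).
Hypothesis sHG : H \subset G.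
Local Notation aG := (regular_repr algC G).

(** Row vectors are elements of the group algebra. As [aG] multiplies them on the right, these
    matrices commute with it. *)
Definition left_mx (x : gT) : 'M[algC]_#|G| :=
  \matrix_i delta_mx 0 (gring_index G (x * enum_val i)).

(* Left multiplication by the idempotent [|H|^-1 \sum_(h in H) h]. *)
Definition avg_mx : 'M[algC]_#|G| :=
  #|H|%:R^-1 *: \sum_(h in H) left_mx h.

Lemma left_mxM : {in G &, forall x y, left_mx x *m left_mx y = left_mx (y * x)}.
Proof.
move=> x y Gx Gy; apply/row_matrixP=> i.
by rewrite row_mul !rowK -rowE rowK gring_indexK ?mulgA // groupM ?enum_valP.
Qed.

Lemma left_mx_comm : {in G &, forall x y, left_mx x *m aG y = aG y *m left_mx x}.
Proof.
move=> x y Gx Gy; apply/row_matrixP=> i.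
rewrite !row_mul !rowK -!rowE !rowK.
by rewrite !gring_indexK ?mulgA // groupM ?enum_valP.
Qed.

Lemma gring_row_left : {in G &, forall x y,
  gring_row (aG x) *m left_mx y = gring_row (aG (y * x)%g)}.
Proof.
move=> x y Gx Gy.
by rewrite /gring_row !rowK -rowE rowK !gring_indexK ?mul1g // groupM ?group1.
Qed.

Lemma avg_mx_comm (x : gT) : x \in G -> avg_mx *m aG x = aG x *m avg_mx.
Proof.
move=> Gx; rewrite -scalemxAl -scalemxAr mulmx_suml mulmx_sumr; congr (_ *: _).
by apply: eq_bigr => h Hh; rewrite left_mx_comm // (subsetP sHG).
Qed.

Let nzH : #|H|%:R != 0 :> algC.
Proof. by rewrite pnatr_eq0 -lt0n cardG_gt0. Qed.

Lemma avg_mx_idem : avg_mx *m avg_mx = avg_mx.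
Proof.
rewrite {1 2}/avg_mx -scalemxAl -scalemxAr mulmx_suml.
rewrite (eq_bigr (fun=> \sum_(h in H) left_mx h)) => [|x Hx]; last first.
  rewrite mulmx_sumr [RHS](reindex_inj (mulIg x)) /=.
  rewrite [RHS](eq_bigl (mem H)) => [|y]; last by rewrite groupMr.
  by apply: eq_bigr => y Hy; rewrite left_mxM ?(subsetP sHG).
by rewrite sumr_const -scaler_nat (scalerA _ #|H|%:R) mulVf // scale1r.
Qed.

Lemma avg_mx_module : mxmodule aG avg_mx.
Proof.
by apply/mxmoduleP=> x Gx; rewrite avg_mx_comm // submxMl.
Qed.

(** The sum over [H] is fixed by left averaging over [H], and [A] commutes with this averaging, so
    the product is fixed too. *)
Lemma sum_regular_sub_avg (A : 'M[algC]_#|G|) :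
  A *m avg_mx = avg_mx *m A ->
  (gring_row ((\sum_(h in H) aG h) *m A) <= avg_mx)%MS.
Proof.
move=> cA; set a := \sum_(h in H) _.
suff aE : gring_row a *m avg_mx = gring_row a.
  by rewrite gring_row_mul -aE -mulmxA -cA mulmxA submxMl.
rewrite -scalemxAr mulmx_sumr (eq_bigr (fun=> gring_row a)) => [|x Hx].
  by rewrite sumr_const -scaler_nat scalerA mulVf // scale1r.
rewrite /a !raddf_sum mulmx_suml [RHS](reindex_inj (mulgI x)) /=.
rewrite [RHS](eq_bigl (mem H)) => [|y]; last by rewrite groupMl.
by apply: eq_bigr => y Hy; rewrite gring_row_left ?(subsetP sHG).
Qed.

(** This is the trivial character of [H] induced to [G]. *)
Definition perm_char : 'CF(G) := cfRepr (submod_repr avg_mx_module).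

Lemma perm_charE (x : gT) : x \in G ->
  perm_char x = #|H|%:R^-1 * #|[set y in G | y * x * y^-1 \in H]%g|%:R.
Proof.
move=> Gx; rewrite cfunE Gx mulr1n (mxtrace_submod_idem _ avg_mx_idem) //.
rewrite -scalemxAl mxtraceZ; congr (_ * _).
rewrite mulmx_suml raddf_sum /=.
(* The diagonal entry at [y] of left multiplication by [h] and right multiplication by [x] is 1
   exactly when [h * y * x] is [y]. *)
transitivity (\sum_(h in H) \sum_(y in G) (h * y * x == y)%g%:R : algC).
  apply: eq_bigr => h Hh; rewrite [RHS]big_enum_val /=.
  apply: eq_bigr => i _.
  have Gh := subsetP sHG h Hh.
  have /(congr1 (fun v : 'rV_#|G| => v 0 i)) :
      row i (left_mx h *m aG x)
      = delta_mx 0 (gring_index G (h * enum_val i * x)%g).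
    by rewrite row_mul rowK -rowE rowK gring_indexK ?groupM ?enum_valP.
  rewrite [LHS]mxE => ->; rewrite mxE eqxx /=; congr (nat_of_bool _)%:R.
  by rewrite -(inj_eq enum_val_inj) gring_indexK ?groupM ?enum_valP // eq_sym.
rewrite exchange_big /= -sum1_card natr_sum.
rewrite [RHS](eq_bigl (fun y => (y \in G) && (y * x * y^-1 \in H)%g));
  last by move=> y; rewrite inE.
rewrite [RHS]big_mkcondr /=; apply: eq_bigr => y Gy.
(* Each [y] admits a single candidate for [h], which counts if it lies in [H]. *)
have eq_h h : (h * y * x == y)%g = (h == (y * x * y^-1)^-1)%g.
  by rewrite eq_mulgV1 [RHS]eq_mulgV1 invgK !mulgA.
under eq_bigr do rewrite eq_h.
rewrite -groupV; case: ifPn => Hz.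
  by rewrite (bigD1 _ Hz) /= eqxx big1 ?addr0 // => h /andP[_ /negbTE->].
rewrite big1 // => h Hh; case: eqP => // def_h.
by rewrite -def_h Hh in Hz.
Qed.

Lemma perm_char_ge_submod (A : 'M[algC]_#|G|)
    (v := gring_row ((\sum_(h in H) aG h) *m A)) :
  A *m avg_mx = avg_mx *m A ->
  perm_char - cfRepr (submod_repr (cyclic_mx_module aG v)) \is a character.
Proof.
move=> cA; apply/cfRepr_submod_le/cyclic_mx_sub; first exact: avg_mx_module.
exact: sum_regular_sub_avg.
Qed.

End PermutationModule.

(** The point [to t y] is fixed by [x] iff [y * x * y^-1] stabilizes [t]; each point of the orbit
    arises from [#|H|] elements [y], which cancels the denominator in [perm_charE]. *)
Lemma perm_char_orbit (gT : finGroupType) (T : finType) (G H : {group gT})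
    (to : {action gT &-> T}) (t : T) (sHG : H \subset G) :
  H = 'C_G[t | to]%g :> {set gT} ->
  {in G, forall x, perm_char sHG x = #|'Fix_(orbit to G t | to)[x]%g|%:R}.
Proof.
move=> defH x Gx; rewrite perm_charE //.
apply: (canLR (mulKf _)); first by rewrite pnatr_eq0 -lt0n cardG_gt0.
rewrite -natrM; congr _%:R.
rewrite -sum1_card (eq_bigl (fun y => (y \in G) && (to (to t y) x == to t y)));
  last first.
  move=> y; rewrite !inE; apply: andb_id2l => Gy.
  have Gz : (y * x * y^-1)%g \in G by rewrite !groupM ?groupV.
  rewrite defH in_setI Gz (sameP astab1P eqP) !actM.
  by rewrite -(inj_eq (act_inj to y)) actKV.
rewrite (partition_big (to t) (mem (orbit to G t))) /=; last first.
  by move=> y /andP[Gy _]; apply: mem_orbit.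
rewrite mulnC -sum_nat_const.
rewrite [RHS](eq_bigl (fun u => (u \in orbit to G t) && (to u x == u)));
  last first.
  by move=> u; rewrite inE (sameP afix1P eqP).
rewrite [RHS]big_mkcondr /=; apply: eq_bigr => u /orbitP[g Gg <-].
case: ifPn => [fx | nfx]; last first.
  rewrite big1 // => y /andP[/andP[_ fx] /eqP def_u].
  by rewrite def_u (negbTE nfx) in fx.
(* The elements moving [t] to [to t g] form the right coset of the stabilizer through [g]. *)
rewrite sum1_card defH -(card_rcoset _ g) -amove_act ?subsetT //.
apply: eq_card => y; rewrite unfold_in /= [RHS]inE -andbA.
apply: andb_id2l => Gy.
by case: (to t y =P to t g) => [-> | _]; rewrite ?andbF ?fx.
Qed.

(** On [S], [f] factors through [g]; the factor takes option values since a point may have no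
    preimage in [S]. *)
Lemma leq_card_imset_in (T R U : finType) (f : T -> R) (g : T -> U)
    (S : {set T}) :
  {in S &, forall x y, g x = g y -> f x = f y} -> (#|f @: S| <= #|g @: S|)%N.
Proof.
move=> gf; pose F u := omap f [pick x in S | g x == u].
rewrite -(card_imset _ Some_inj).
apply: leq_trans (leq_imset_card F _); apply/subset_leq_card/subsetP.
move=> _ /imsetP[_ /imsetP[x Sx ->] ->]; apply/imsetP; exists (g x).
  exact: imset_f.
rewrite /F; case: pickP => [y /andP[Sy /eqP gy] | /(_ x)] /=.
  by rewrite (gf y x).
by rewrite Sx eqxx.
Qed.

(** * Orbits on products and relabellings *)

Section ProductAction.

Variables (aT : finGroupType) (T1 T2 : finType).
Variables (to1 : {action aT &-> T1}) (to2 : {action aT &-> T2}).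

Definition prod_act (x : T1 * T2) (a : aT) := (to1 x.1 a, to2 x.2 a).

Fact prod_act1 : prod_act^~ 1%g =1 id.
Proof. by case=> x1 x2; rewrite /prod_act !act1. Qed.

Fact prod_actM x : act_morph prod_act x.
Proof. by move=> a b; rewrite /prod_act !actM. Qed.

Canonical prod_action := TotalAction prod_act1 prod_actM.

Lemma afix_prod (S1 : {set T1}) (S2 : {set T2}) (a : aT) :
  'Fix_(setX S1 S2 | prod_action)[a]%g =
  setX 'Fix_(S1 | to1)[a]%g 'Fix_(S2 | to2)[a]%g.
Proof.
apply/setP=> -[x1 x2]; rewrite in_setX !in_setI in_setX /=.
have -> : ((x1, x2) \in 'Fix_prod_action[a]%g)
        = (x1 \in 'Fix_to1[a]%g) && (x2 \in 'Fix_to2[a]%g).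
  apply/afix1P/andP => /= [[/afix1P ? /afix1P ?] // | [/afix1P e1 /afix1P e2]].
  by rewrite /prod_act /= e1 e2.
by rewrite andbACA.
Qed.

Lemma acts_prod (G : {set aT}) (S1 : {set T1}) (S2 : {set T2}) :
    [acts G, on S1 | to1] -> [acts G, on S2 | to2] ->
  [acts G, on setX S1 S2 | prod_action].
Proof.
move=> /actsP GS1 /actsP GS2; apply/actsP=> a Ga [x1 x2] /=.
by rewrite !in_setX /= GS1 ?GS2.
Qed.

End ProductAction.

Section Relabelling.

Variables (n : nat) (K : finType).

(** Tabloids are encoded as maps from boxes to row labels; the inverse makes this a right action. *)
Definition relabel (h : {ffun 'I_n -> K}) (s : 'S_n) : {ffun 'I_n -> K} :=
  [ffun i => h ((s^-1)%g i)].

Fact relabel1 : relabel^~ 1%g =1 id.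
Proof. by move=> h; apply/ffunP=> i; rewrite ffunE invg1 perm1. Qed.

Fact relabelM h : act_morph relabel h.
Proof. by move=> s t; apply/ffunP=> i; rewrite !ffunE invMg permM. Qed.

Canonical relabel_action := TotalAction relabel1 relabelM.

(** Equal fibre sizes make the lists of values of [f] and [g] permutations of each other. *)
Lemma relabelP (f g : 'I_n -> K) :
  (forall k, #|[set i | f i == k]| = #|[set i | g i == k]|) ->
  exists s : 'S_n, forall i, f i = g (s i).
Proof.
move=> fg; pose u := [tuple f i | i < n]; pose v := [tuple g i | i < n].
have count_tuple (e : 'I_n -> K) k :
    count_mem k [tuple e i | i < n] = #|[set i | e i == k]|.
  by rewrite /= count_map cardsE cardE enumT size_filter.
have /tuple_permP[s eq_uv] : perm_eq u v.
  by rewrite /perm_eq; apply/allP=> k _ /=; rewrite !count_tuple fg.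
exists s => i; have := congr1 (fun w : n.-tuple K => tnth w i) (val_inj eq_uv).
by rewrite !tnth_mktuple.
Qed.

Lemma card_fiber_orbit (f h : {ffun 'I_n -> K}) (k : K) :
  h \in orbit relabel_action [set: 'S_n] f ->
  (#|[set i | h i == k]| <= #|[set i | f i == k]|)%N.
Proof.
case/orbitP=> s _ <-; rewrite -(card_imset _ (@perm_inj _ (s^-1)%g)).
apply/subset_leq_card/subsetP=> _ /imsetP[i + ->].
by rewrite !inE /= ffunE.
Qed.

End Relabelling.

Section TripleOrbits.

Variables (n c : nat) (K1 K2 K3 : finType).
Variables (f1 : {ffun 'I_n -> K1}) (f2 : {ffun 'I_n -> K2}).
Variable (f3 : {ffun 'I_n -> K3}).

Local Notation G := [set: 'S_n].
Local Notation O1 := (orbit (@relabel_action n K1) G f1).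
Local Notation O2 := (orbit (@relabel_action n K2) G f2).
Local Notation O3 := (orbit (@relabel_action n K3) G f3).
Local Notation to := (prod_action (prod_action (@relabel_action n K1)
  (@relabel_action n K2)) (@relabel_action n K3)).

Hypothesis f1c : forall k, (#|[set i | f1 i == k]| <= c)%N.

(* The orbit of a triple of labellings is determined by the three-dimensional
   array counting the points with given labels. *)
Lemma card_triple_orbits :
  (#|orbit to G @: setX (setX O1 O2) O3| <= c.+1 ^ (#|K1| * #|K2| * #|K3|))%N.
Proof.
pose joint (t : {ffun 'I_n -> K1} * {ffun 'I_n -> K2} * {ffun 'I_n -> K3}) i :=
  (t.1.1 i, t.1.2 i, t.2 i).
pose hist t : {ffun K1 * K2 * K3 -> 'I_c.+1} :=
  [ffun k => inord #|[set i | joint t i == k]|].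
have -> : (c.+1 ^ (#|K1| * #|K2| * #|K3|))%N
        = #|{ffun K1 * K2 * K3 -> 'I_c.+1}|.
  by rewrite card_ffun card_ord !card_prod.
(* The truncation by [inord] is harmless: a fibre of the joint labelling lies in a fibre of its
   first component, which has at most [c] points. *)
have histK t k : t \in setX (setX O1 O2) O3 ->
    hist t k = #|[set i | joint t i == k]| :> nat.
  case: t => -[h1 h2] h3; rewrite !in_setX /= -andbA => /and3P[Oh1 _ _].
  rewrite ffunE inordK // ltnS.
  apply: leq_trans (leq_trans (card_fiber_orbit k.1.1 Oh1) (f1c _)).
  by apply/subset_leq_card/subsetP=> i; rewrite !inE => /eqP <-.
apply: leq_trans (max_card (mem (hist @: setX (setX O1 O2) O3))).
apply: leq_card_imset_in => t t' St St' eq_hist.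
have [|s eq_s] := relabelP (f := joint t) (g := joint t').
  by move=> k; rewrite -!histK // eq_hist.
apply/eqP; rewrite orbit_eq_mem; apply/orbitP; exists (s^-1)%g; rewrite ?inE //.
case: t t' {St St' eq_hist} eq_s => -[h1 h2] h3 [[h1' h2'] h3'] eq_s.
by congr (_, _, _); apply/ffunP=> i; rewrite ffunE invgK;
  case: (eq_s i).
Qed.

(** Cauchy-Frobenius orbit counting, where the fixed points on a product are the product of the
    fixed points. *)
Lemma sum_fix_triple :
  \sum_(s : 'S_n) (#|'Fix_(O1 | @relabel_action n K1)[s]%g|
    * #|'Fix_(O2 | @relabel_action n K2)[s]%g|
    * #|'Fix_(O3 | @relabel_action n K3)[s]%g|)%N
  = (#|orbit to G @: setX (setX O1 O2) O3| * n`!)%N.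
Proof.
have acts_S : [acts G, on setX (setX O1 O2) O3 | to].
  by rewrite !acts_prod ?acts_orbit ?subsetT.
have := Frobenius_Cauchy acts_S; rewrite cardsT card_Sn => <-.
by apply: eq_big => s; rewrite ?inE // => _; rewrite !afix_prod !cardsX.
Qed.

End TripleOrbits.

(** * Monotonicity of products and multiplicities of characters *)

Lemma char_mul_le (gT : finGroupType) (G : {group gT})
    (phi1 phi2 psi1 psi2 : 'CF(G)) :
    phi1 \is a character -> phi2 \is a character ->
    psi1 - phi1 \is a character -> psi2 - phi2 \is a character ->
  psi1 * psi2 - phi1 * phi2 \is a character.
Proof.
move=> Nphi1 Nphi2 Npsi1 Npsi2.
(* Every factor on the right is a character or a sum of two. *)
have -> : psi1 * psi2 - phi1 * phi2
        = (psi1 - phi1) * (psi2 - phi2 + phi2) + phi1 * (psi2 - phi2).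
  by rewrite subrK mulrBl mulrBr addrA subrK.
apply: rpredD; apply: rpredM => //; exact: rpredD.
Qed.

Lemma cfdot1_le (gT : finGroupType) (G : {group gT}) (phi psi : 'CF(G)) :
  psi - phi \is a character -> '[phi, 1] <= '[psi, 1].
Proof.
by move=> Nd; rewrite -subr_ge0 -cfdotBl natr_ge0 ?Cnat_cfdot_char ?cfun1_char.
Qed.

(** * Tabloids and the Specht module *)

Section RowLabelling.

Variables (n : nat) (la : seq nat).
Hypothesis la_n : is_partition n la.

Fact row_label_subproof (i : 'I_n) : (reshape_index la i < size la)%N.
Proof. by apply: reshape_indexP; case/and3P: la_n => _ _ /eqP->. Qed.

Definition row_label : {ffun 'I_n -> 'I_(size la)} :=
  [ffun i => Ordinal (row_label_subproof i)].

Lemma row_group_stab :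
  row_group n la
  = 'C_([set: 'S_n])[row_label | @relabel_action n 'I_(size la)]%g.
Proof.
apply/setP=> s; rewrite in_setI in_setT inE.
apply/forallP/astab1P => [rs | /ffunP rs i].
  apply/ffunP=> i; apply: val_inj; rewrite !ffunE /=.
  by have /eqP := rs ((s^-1)%g i); rewrite permKV.
by have /(congr1 val) := rs (s i); rewrite !ffunE /= permK => ->.
Qed.

(** Boxes of one row have distinct columns, all below the length of that row, which is at most the
    first part. *)
Lemma card_row_label (k : 'I_(size la)) :
  (#|[set i | row_label i == k]| <= head 0 la)%N.
Proof.
have [srt _ /eqP sum_la] := and3P la_n.
have le_head j : (nth 0 la j <= head 0 la)%N.
  case: la srt j => [|x s] /= srt [|j] //=.
  have /all_nthP/= := order_path_min (rev_trans leq_trans) srt.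
  have [lt_js /(_ 0%N j lt_js) // | ge_js _] := ltnP j (size s).
  by rewrite nth_default.
set A := [set i | _].
rewrite cardE -(size_map (fun i : 'I_n => reshape_offset la i)).
rewrite -[leqRHS](size_iota 0); apply: uniq_leq_size.
  rewrite map_inj_in_uniq ?enum_uniq // => i j.
  rewrite !mem_enum !inE => /eqP ri /eqP rj eq_off; apply: val_inj => /=.
  rewrite -(reshape_indexK la i) -(reshape_indexK la j) eq_off.
  by have /(congr1 val) := etrans ri (esym rj); rewrite !ffunE /= => ->.
move=> _ /mapP[i _ ->]; rewrite mem_iota /= add0n.
apply: leq_trans (le_head (reshape_index la i)).
by rewrite reshape_offsetP ?sum_la.
Qed.

(** The row group is the stabilizer of [row_label]. The column factor of the symmetrizer is a
    combination of right multiplications, hence commutes with left averaging, so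
    [perm_char_ge_submod] applies. *)
Lemma specht_char_le_tabloid :
  exists2 psi : 'CF([set: 'S_n]), psi - specht_char n la \is a character
  & forall s : 'S_n, psi s
    = #|'Fix_(orbit (@relabel_action n _) [set: 'S_n] row_label
              | @relabel_action n _)[s]%g|%:R.
Proof.
pose H := 'C_([set: 'S_n])[row_label | @relabel_action n 'I_(size la)]%G.
have sHG : H \subset [set: 'S_n]%G by apply: subsetT.
exists (perm_char sHG); last first.
  by move=> s; apply: perm_char_orbit => //; rewrite inE.
rewrite /specht_char /specht_repr /young_symmetrizer row_group_stab.
apply: perm_char_ge_submod; rewrite mulmx_suml mulmx_sumr.
apply: eq_bigr => q _.
rewrite -[LHS]scalemxAl -[RHS]scalemxAr; congr (_ *: _).
by apply/esym/(avg_mx_comm sHG); rewrite inE.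
Qed.

End RowLabelling.

(** * Bounding the Kronecker coefficient *)

Lemma specht_char_char (n : nat) (la : seq nat) :
  specht_char n la \is a character.
Proof. exact: cfRepr_char. Qed.

Lemma kronecker_cfdot (n : nat) (la mu nu : seq nat) :
  kronecker n la mu nu
  = '[specht_char n la * specht_char n mu * specht_char n nu, 1].
Proof.
rewrite cfdotE cardsT card_Sn /kronecker; congr (_ * _).
apply: eq_big => s; first by rewrite inE.
by move=> _; rewrite cfun1E in_setT rmorph1 mulr1 !cfunE.
Qed.

(** The coefficient is the multiplicity of the trivial character in a product of Specht characters.
    Replacing these by tabloid characters can only increase it, and then it counts orbits on triples
    of tabloids. *)
Lemma kronecker_le_arrays (n c : nat) (la mu nu : seq nat) :
    is_partition n la -> is_partition n mu -> is_partition n nu ->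
    (head 0 la <= c)%N ->
  kronecker n la mu nu
  <= (c.+1 ^ (size la * size mu * size nu))%:R.
Proof.
move=> la_n mu_n nu_n le_c; rewrite kronecker_cfdot.
have [psi1 le1 psi1E] := specht_char_le_tabloid la_n.
have [psi2 le2 psi2E] := specht_char_le_tabloid mu_n.
have [psi3 le3 psi3E] := specht_char_le_tabloid nu_n.
apply: le_trans (cfdot1_le (char_mul_le _ _ (char_mul_le _ _ le1 le2) le3)) _;
  rewrite ?rpredM ?specht_char_char //.
rewrite cfdotE cardsT card_Sn.
have -> : \sum_(s in [set: 'S_n]) (psi1 * psi2 * psi3) s * ((1 : 'CF([set: 'S_n])) s)^*
    = (#|orbit (prod_action (prod_action (@relabel_action n _)
          (@relabel_action n _)) (@relabel_action n _)) [set: 'S_n]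
       @: setX (setX (orbit (@relabel_action n _) [set: 'S_n] (row_label la_n))
                     (orbit (@relabel_action n _) [set: 'S_n] (row_label mu_n)))
           (orbit (@relabel_action n _) [set: 'S_n] (row_label nu_n))| * n`!)%:R.
  rewrite -sum_fix_triple natr_sum; apply: eq_big => s; first by rewrite inE.
  by move=> _; rewrite cfun1E in_setT rmorph1 mulr1 !cfunE psi1E psi2E psi3E !natrM.
rewrite natrM mulrCA mulVf ?mulr1 ?pnatr_eq0 -?lt0n ?fact_gt0 //.
rewrite ler_nat (leq_trans (card_triple_orbits (c := c) _ _ _)) ?card_ord //.
by move=> k; apply: leq_trans (card_row_label la_n k) le_c.
Qed.

Lemma kroneckerC (n : nat) (la mu nu : seq nat) :
  kronecker n la mu nu = kronecker n mu la nu.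
Proof.
rewrite /kronecker; congr (_ * _); apply: eq_bigr => s _.
by rewrite (mulrC (specht_char n la s)).
Qed.

Lemma num_partitions_gt0 (n : nat) (la : seq nat) :
  is_partition n la -> (0 < num_partitions n)%N.
Proof.
move=> la_n; have [t def_t] := is_partition_bseq la_n.
by apply/card_gt0P; exists t; rewrite inE def_t.
Qed.

Lemma partition_size_gt0 (n : nat) (la : seq nat) :
  is_partition n la -> (0 < size la)%N = (0 < n)%N.
Proof.
case/and3P=> _ la0 /eqP <-; case: la la0 => //= x la.
by rewrite inE negb_or eq_sym -lt0n addn_gt0 => /andP[->].
Qed.

(* AM-GM in the exponent: [2 a b <= a^2 + b^2]. *)
Lemma exp_le_sqrtC_mul (a b k x y z : nat) : (0 < x <= y)%N -> (x <= z)%N ->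
  (x ^ (a * b * k))%:R
  <= sqrtC y%:R ^+ (k * a ^ 2) * sqrtC z%:R ^+ (k * b ^ 2) :> algC.
Proof.
case/andP=> x_gt0 le_xy le_xz.
have sx_ge1 : 1 <= sqrtC x%:R :> algC.
  by rewrite -[leLHS]sqrtC1 ler_sqrtC ?nnegrE ?ler01 ?ler0n // ler1n.
have -> : (x ^ (a * b * k))%:R = sqrtC x%:R ^+ (k * (2 * (a * b))) :> algC.
  by rewrite natrX -[in LHS](sqrtCK x%:R) -exprM [(k * _)%N]mulnC mulnA.
have le2 : (k * (2 * (a * b)) <= k * a ^ 2 + k * b ^ 2)%N.
  by rewrite -mulnDr leq_mul2l nat_Cauchy orbT.
apply: le_trans (ler_weXn2l sx_ge1 le2) _; rewrite exprD.
have pow_le w e : (x <= w)%N -> sqrtC x%:R ^+ e <= sqrtC w%:R ^+ e :> algC.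
  by move=> le_xw;
    rewrite lerXn2r ?nnegrE ?sqrtC_ge0 ?ler0n // ler_sqrtC ?nnegrE ?ler0n ?ler_nat.
by rewrite ler_pM ?exprn_ge0 ?sqrtC_ge0 ?ler0n ?pow_le.
Qed.

Theorem theorem7p5 (n l m r : nat) (la mu nu : seq nat)
  (hla : is_partition n la) (hmu : is_partition n mu) (hnu : is_partition n nu)
  (hl : size la = l) (hm : size mu = m) (hr : size nu = r) :
  kronecker n la mu nu <=
    (r`!)%:R * (num_partitions n)%:R ^+ (3 * r - 2) * n%:R ^+ (r - 1)
    * sqrtC (l + head 0%N la)%:R ^+ (r * l ^ 2)
    * sqrtC (m + head 0%N mu)%:R ^+ (r * m ^ 2).
Proof.
set p := num_partitions n.
(* The factors before the square roots are only needed to be at least 1. *)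
have prefix_ge1 : 1 <= (r`!)%:R * p%:R ^+ (3 * r - 2) * n%:R ^+ (r - 1) :> algC.
  have p_gt0 : (0 < p)%N := num_partitions_gt0 hla.
  rewrite -!natrX -!natrM ler1n !muln_gt0 fact_gt0 !expn_gt0 p_gt0 /=.
  (* For [r = 0] the truncated exponent [r - 1] is 0, so [n] may vanish; otherwise [n] is
     positive. *)
  case: r hr => [|r'] hr; first by rewrite sub0n eqxx orbT.
  by rewrite -(partition_size_gt0 hnu) hr.
suff le_main : kronecker n la mu nu <= sqrtC (l + head 0%N la)%:R ^+ (r * l ^ 2)
    * sqrtC (m + head 0%N mu)%:R ^+ (r * m ^ 2).
  apply: le_trans le_main _; rewrite -[leRHS]mulrA ler_peMl //.
  by rewrite mulr_ge0 ?exprn_ge0 ?sqrtC_ge0 ?ler0n.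
have [r0 | r_gt0] := posnP r.
  have := kronecker_le_arrays hla hmu hnu (leqnn _).
  by rewrite hr r0 muln0 !mul0n !expr0 mulr1.
have n_gt0 : (0 < n)%N by rewrite -(partition_size_gt0 hnu) hr.
have l_gt0 : (0 < l)%N by rewrite -hl (partition_size_gt0 hla).
have m_gt0 : (0 < m)%N by rewrite -hm (partition_size_gt0 hmu).
(* A positive number of parts absorbs the 1 added to the first part in the base of the array
   count. *)
have lt_head k h h' : (0 < k -> h <= h' -> h < k + h')%N.
  by move=> k_gt0 le_h; rewrite -add1n leq_add.
(* The smaller of the two first parts serves as [c], so that the base is below both [l + head 0 la]
   and [m + head 0 mu]; symmetry in [la] and [mu] gives the second case. *)
have [le_h | /ltnW le_h] := leqP (head 0%N la) (head 0%N mu).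
  apply: le_trans (kronecker_le_arrays hla hmu hnu (leqnn _)) _.
  by rewrite hl hm hr exp_le_sqrtC_mul ?lt_head.
rewrite kroneckerC mulrC.
apply: le_trans (kronecker_le_arrays hmu hla hnu (leqnn _)) _.
by rewrite hl hm hr exp_le_sqrtC_mul ?lt_head.
Qed.
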